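(* Let $f\in\mathbb{C}[X,Y]$ be a quasi-convenient polynomial such that (1) $f$ is nondegenerate at infinity, and (2) for every nonzero real vector $\vec w=[p,q]$ with $pq\le 0$, the system of equations $\operatorname{in}(f,\vec w)(X,Y)=\operatorname{in}(f,-\vec w)(X,Y)=0$ has no solutions in $\mathbb{C}^*\times\mathbb{C}^*$. Then $f$ is nearly irreducible.
   Context: Write $f=\sum c_{\alpha\beta}X^\alpha Y^\beta\in\mathbb{C}[X,Y]$ and $\operatorname{supp} f=\{(\alpha,\beta)\in\mathbb{N}^2: c_{\alpha\beta}\neq 0\}$. A nonzero polynomial $f$ of positive degree is quasi-convenient if $c_{\alpha 0}\neq 0$ and $c_{0\beta}\neq 0$ for some integers $\alpha,\beta\ge 0$. For a nonzero real vector $\vec w=[p,q]$, let $d_{\vec w}(f)=\max\{p\alpha+q\beta:(\alpha,\beta)\in\operatorname{supp} f\}$ and $\operatorname{in}(f,\vec w)=\sum_{p\alpha+q\beta=d_{\vec w}(f)} c_{\alpha\beta}X^\alpha Y^\beta$. A quasi-convenient $f$ is nondegenerate at infinity if for every real vector $\vec w=[p,q]$ with $p>0$ or $q>0$ the system $\operatorname{in}(f,\vec w)=\frac{\partial}{\partial X}\operatorname{in}(f,\vec w)=\frac{\partial}{\partial Y}\operatorname{in}(f,\vec w)=0$ has no solutions in $\mathbb{C}^*\times\mathbb{C}^*$, where $\mathbb{C}^*=\mathbb{C}\setminus\{0\}$. A polynomial $f$ of positive degree is nearly irreducible if any two nonconstant polynomial factors $g,h\in\mathbb{C}[X,Y]$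 of $f$ have a common zero in $\mathbb{C}^2$. *)

(* Defs.v *)
(* Bivariate polynomials C[X,Y] are represented as
   {poly {poly C}}: the OUTER variable is X and the INNER variable is Y,
   so f = \sum_a (f`_a) X^a with f`_a in C[Y], and the coefficient of
   X^a Y^b is (f`_a)`_b.  Evaluation f(x,y) = (f.[x%:P]).[y]. *)
From HB Require Import structures.
From mathcomp Require Import all_boot all_order all_algebra.
Set Implicit Arguments. Unset Strict Implicit. Unset Printing Implicit Defensive.
Import Order.TTheory GRing.Theory Num.Theory.
Local Open Scope ring_scope.

Section Bivariate.
Variable C : numClosedFieldType.

Definition bcoef (f : {poly {poly C}}) (a b : nat) : C := (f`_a)`_b.

Definition beval (f : {poly {poly C}}) (x y : C) : C := (f.[x%:P]).[y].

Definition dX (f : {poly {poly C}}) : {poly {poly C}} := f^`().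
Definition dY (f : {poly {poly C}}) : {poly {poly C}} := map_poly (@deriv C) f.

Definition pos_deg (f : {poly {poly C}}) : Prop :=
  exists a b : nat, (0 < a + b)%N /\ bcoef f a b != 0.

Definition quasi_convenient (f : {poly {poly C}}) : Prop :=
  pos_deg f /\ (exists a, bcoef f a 0 != 0) /\ (exists b, bcoef f 0 b != 0).

(* bound on the Y-degree: every monomial in supp f has b < ybound f *)
Definition ybound (f : {poly {poly C}}) : nat := (\max_(i < size f) size (f`_i)%R)%N.

Definition is_wmax (f : {poly {poly C}}) (p q : C) (a b : nat) : bool :=
  [forall a' : 'I_(size f), forall b' : 'I_(ybound f),
     (bcoef f a' b' != 0) ==>
       (p * (a' : nat)%:R + q * (b' : nat)%:R <= p * a%:R + q * b%:R)].

Definition initial_form (f : {poly {poly C}}) (p q : C) : {poly {poly C}} :=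
  \poly_(a < size f) \poly_(b < size f`_a)
     (if is_wmax f p q a b then bcoef f a b else 0).

Definition nondegenerate_at_infinity (f : {poly {poly C}}) : Prop :=
  quasi_convenient f /\
  forall p q : C, p \is Num.real -> q \is Num.real -> (0 < p \/ 0 < q) ->
    ~ (exists x y : C, x != 0 /\ y != 0 /\
         beval (initial_form f p q) x y = 0 /\
         beval (dX (initial_form f p q)) x y = 0 /\
         beval (dY (initial_form f p q)) x y = 0).

Definition bdvd (g f : {poly {poly C}}) : Prop := exists k, f = g * k.

Definition nearly_irreducible (f : {poly {poly C}}) : Prop :=
  pos_deg f /\
  forall g h : {poly {poly C}}, pos_deg g -> pos_deg h -> bdvd g f -> bdvd h f ->
    exists x y : C, beval g x y = 0 /\ beval h x y = 0.

End Bivariate.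

(* Main.v *)
Require Import Defs.
From HB Require Import structures.
From mathcomp Require Import all_boot all_order all_algebra all_field.
From mathcomp Require Import boolp classical_sets.
From mathcomp Require Import zify ring.
Set Implicit Arguments. Unset Strict Implicit. Unset Printing Implicit Defensive.
Import Order.TTheory GRing.Theory Num.Theory.
Local Open Scope ring_scope.

(** Suppose that factors [g], [h] of [f] have no common zero. By the Nullstellensatz
    [u g + v h = 1], hence [g h] divides [f]. Let [(x, y)] be a generic point of a
    component of [g = 0], in a field [K] over [C]. A valuation ring [O] of [K] over [C]
    which misses [x] or [y] attaches to [(x, y)] a weight [w = (p, q)] with [p > 0] or
    [q > 0] and a residual torus point at which [in(g, w)] vanishes. By nondegeneracy
    [in(h, w)] does not vanish there, so [h(x, y)] has a pole of order exactly
    [d_w(h)], which dominates the pole of [1] and of every monomial of [h]. As [h(x, y)]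
    is a unit wherever [x, y] are both in [O], the ratios [1 / h(x, y)] and
    [x^a y^b / h(x, y)], for [(a, b)] in [supp h], lie in every valuation ring, hence are
    constants. So the monomials of [h] are constant at [(x, y)], and [supp h] lies
    on a line through the origin, since otherwise [x] and [y] would be constants. If [w]
    is orthogonal to that line then [in(h, w) = in(h, -w) = h], which has a torus
    zero: this contradicts the second hypothesis on [f]. *)

(** * Weights and initial forms *)

Section Bipoly.
Variable C : numClosedFieldType.
Implicit Types (f g h : {poly {poly C}}) (m : nat * nat).

Lemma bpolyP f g : (forall a b, bcoef f a b = bcoef g a b) -> f = g.
Proof. by move=> e; apply/polyP=> a; apply/polyP=> b; apply: e. Qed.

Lemma bcoef_bounds f a b :
  bcoef f a b != 0 -> (a < size f)%N /\ (b < ybound f)%N.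
Proof.
rewrite /bcoef => nz.
have lta : (a < size f)%N.
  by rewrite ltnNge; apply/negP=> le; rewrite (nth_default _ le) coef0 eqxx in nz.
split=> //; have : (b < size (f`_a)%R)%N.
  by rewrite ltnNge; apply/negP=> le; rewrite (nth_default _ le) eqxx in nz.
move/leq_trans; apply.
exact: (leq_bigmax (Ordinal lta) (F := fun i : 'I__ => size f`_i)).
Qed.

Lemma bcoefM f g a b :
  bcoef (f * g) a b =
  \sum_(i < a.+1) \sum_(j < b.+1) bcoef f i j * bcoef g (a - i) (b - j).
Proof.
rewrite /bcoef coefM coef_sum; apply: eq_bigr => i _.
by rewrite coefM.
Qed.

Lemma dYM f g : dY (f * g) = dY f * g + f * dY g.
Proof.
have dYE h a : (dY h)`_a = (h`_a)^`() by rewrite /dY coef_map_id0 ?deriv0.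
apply/polyP=> a; rewrite dYE coefD !coefM raddf_sum -big_split /=.
by apply: eq_bigr => i _; rewrite derivM !dYE.
Qed.

Definition bsupp f : seq (nat * nat) :=
  [seq m <- [seq (a, b) | a <- index_iota 0 (size f), b <- index_iota 0 (ybound f)]
  | bcoef f m.1 m.2 != 0].

Lemma mem_bsupp f m : (m \in bsupp f) = (bcoef f m.1 m.2 != 0).
Proof.
rewrite mem_filter; case: (boolP (_ != 0)) => //= /bcoef_bounds [lta ltb].
by case: m lta ltb => a b /= lta ltb; apply: allpairs_f; rewrite mem_index_iota.
Qed.

Lemma bsupp_uniq f : uniq (bsupp f).
Proof.
by apply: filter_uniq; apply: allpairs_uniq; rewrite ?iota_uniq // => -[? ?] [? ?].
Qed.


Lemma bsupp_neq0 f : f != 0 -> bsupp f != [::].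
Proof.
apply: contraNneq => s0; apply/eqP; apply: bpolyP => a b; apply/eqP.
rewrite {2}/bcoef !coef0.
by have := mem_bsupp f (a, b); rewrite s0 /= => /esym/negbFE.
Qed.

(** [beval] only has points with coordinates in [C]. Generic points live in a larger field [K],
    which is reached by pushing the coefficients through [j]. *)
Definition ev (K : fieldType) (j : {rmorphism C -> K}) (x y : K) f : K :=
  (map_poly (horner_eval y \o map_poly j) f).[x].

Section Ev.
Variables (K : fieldType) (j : {rmorphism C -> K}) (x y : K).

Lemma evM f g : ev j x y (f * g) = ev j x y f * ev j x y g.
Proof. by rewrite /ev rmorphM hornerM. Qed.

Lemma evD f g : ev j x y (f + g) = ev j x y f + ev j x y g.
Proof. by rewrite /ev rmorphD hornerD. Qed.

Lemma ev1 : ev j x y 1 = 1.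
Proof. by rewrite /ev rmorph1 hornerC. Qed.

Lemma ev_bsupp f : ev j x y f =
  \sum_(m <- bsupp f) j (bcoef f m.1 m.2) * (x ^+ m.1 * y ^+ m.2).
Proof.
rewrite big_filter big_mkcond /=.
rewrite (eq_bigr (fun m => j (bcoef f m.1 m.2) * (x ^+ m.1 * y ^+ m.2))); last first.
  by move=> m _; case: eqP => //= ->; rewrite rmorph0 mul0r.
rewrite big_allpairs /ev (@horner_coef_wide _ (size f)) ?size_poly //.
rewrite big_mkord; apply: eq_bigr => a _.
rewrite coef_map /= /horner_eval (@horner_coef_wide _ (ybound f)).
  rewrite mulr_suml big_mkord; apply: eq_bigr => b _.
  by rewrite coef_map /= -mulrA [x ^+ _ * _]mulrC.
rewrite size_map_poly.
exact: (leq_bigmax a (F := fun i : 'I__ => size f`_i)).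
Qed.

Lemma ev_wide f (s : seq (nat * nat)) : uniq s -> {subset bsupp f <= s} ->
  ev j x y f = \sum_(m <- s) j (bcoef f m.1 m.2) * (x ^+ m.1 * y ^+ m.2).
Proof.
move=> us sub; rewrite ev_bsupp.
rewrite [RHS](bigID (mem (bsupp f))) /= [X in _ + X]big1 ?addr0; last first.
  by move=> m; rewrite mem_bsupp negbK => /eqP ->; rewrite rmorph0 mul0r.
rewrite -[RHS]big_filter; apply: perm_big; apply: uniq_perm.
- exact: bsupp_uniq.
- exact: filter_uniq.
by move=> m; rewrite [RHS]mem_filter /=; apply/idP/andP=> [i|[]//]; split=> //; apply: sub.
Qed.

End Ev.

Lemma beval_ev f x y : beval f x y = ev idfun x y f.
Proof.
rewrite /beval -[LHS]/(horner_eval y _) [f.[x%:P]]horner_coef raddf_sum.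
rewrite /ev [RHS](@horner_coef_wide _ (size f)) ?size_poly //.
apply: eq_bigr => i _.
by rewrite coef_map /= map_poly_id // /horner_eval hornerM horner_exp hornerC.
Qed.

Lemma bevalM f g x y : beval (f * g) x y = beval f x y * beval g x y.
Proof. by rewrite !beval_ev evM. Qed.

Lemma bevalD f g x y : beval (f + g) x y = beval f x y + beval g x y.
Proof. by rewrite !beval_ev evD. Qed.

Section Weight.
Variables p q : int.

(** Integer weights suffice: those met below come from exponents of monomials, either through a
    valuation ring or as a vector orthogonal to a support. *)
Definition wt m : int := p * m.1%:Z + q * m.2%:Z.

Definition wpart (d : int) f : {poly {poly C}} :=
  \poly_(a < size f) \poly_(b < ybound f)
    (if wt (a, b) == d then bcoef f a b else 0).

Lemma bcoef_wpart d f a b :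
  bcoef (wpart d f) a b = if wt (a, b) == d then bcoef f a b else 0.
Proof.
have [/bcoef_bounds [lta ltb]|] := boolP (bcoef f a b != 0).
  by rewrite /bcoef !coef_poly lta coef_poly ltb.
rewrite negbK => /eqP e; rewrite {1}/bcoef coef_poly e if_same.
case: ltnP => _; last by rewrite coef0.
by rewrite coef_poly e !if_same.
Qed.

Definition wle (d : int) f := forall m, m \in bsupp f -> wt m <= d.
Definition wtop (d : int) f := wle d f /\ wpart d f != 0.

Lemma wtop_exists f : f != 0 -> exists d, wtop d f.
Proof.
move=> /bsupp_neq0.
case E: (bsupp f) => [//|m0 s] _.
have [m ms mmax] : exists2 m, m \in bsupp f & wle (wt m) f.
  rewrite /wle E; elim: s m0 {E} => [|m1 s IH] m0.
    by exists m0; rewrite ?mem_head // => m; rewrite inE => /eqP ->.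
  have [m ms mmax] := IH m1.
  have [le|lt] := leP (wt m0) (wt m).
    exists m; first by rewrite inE ms orbT.
    by move=> n; rewrite inE => /orP[/eqP -> //|/mmax].
  exists m0; first by rewrite mem_head.
  move=> n; rewrite inE => /orP[/eqP -> //|/mmax] /le_trans; apply; exact: ltW.
exists (wt m); split=> //; apply/eqP=> e.
move: ms; rewrite mem_bsupp.
have := bcoef_wpart (wt m) f m.1 m.2; rewrite -surjective_pairing eqxx e.
by rewrite {1}/bcoef !coef0 => <-; rewrite eqxx.
Qed.

Lemma wtM m n : wt (m.1 + n.1, m.2 + n.2)%N = wt m + wt n.
Proof. rewrite /wt /=; lia. Qed.

(** Monomials of weights at most [d] and [e] have a product of weight [d + e] only if both bounds
    are attained, so the other products do not reach the top part. *)
Lemma wpartM d e f g : wle d f -> wle e g ->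
  wle (d + e) (f * g) /\ wpart (d + e) (f * g) = wpart d f * wpart e g.
Proof.
move=> lf lg.
have wtD a b (i : 'I_a.+1) (k : 'I_b.+1) :
    wt (a, b) = wt (i : nat, k : nat) + wt (a - i, b - k)%N.
  by rewrite -wtM /= !subnKC // -ltnS.
split.
  case=> a b; apply: contraTT; rewrite mem_bsupp negbK /= -ltNge => lt.
  rewrite bcoefM big1 // => i _; rewrite big1 // => k _.
  apply/eqP; rewrite mulf_eq0; apply: contraTT lt.
  rewrite negb_or -(mem_bsupp _ (i : nat, k : nat)) -(mem_bsupp _ (a - i, b - k)%N).
  case/andP=> /lf l1 /lg l2.
  by rewrite -leNgt (wtD a b i k) lerD.
apply: bpolyP => a b; rewrite bcoef_wpart !bcoefM.
case: eqP => E.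
  apply: eq_bigr => i _; apply: eq_bigr => k _; rewrite !bcoef_wpart.
  have [z|nz1] := eqVneq (bcoef f i k) 0; first by rewrite z if_same !mul0r.
  have [z|nz2] := eqVneq (bcoef g (a - i) (b - k)) 0; first by rewrite z if_same !mulr0.
  have := lf (i : nat, k : nat); rewrite mem_bsupp => /(_ nz1) l1.
  have := lg (a - i, b - k)%N; rewrite mem_bsupp => /(_ nz2) l2.
  have E' := wtD a b i k.
  have [-> ->] : wt (i : nat, k : nat) = d /\ wt (a - i, b - k)%N = e by lia.
  by rewrite !eqxx.
rewrite big1 // => i _; rewrite big1 // => k _; rewrite !bcoef_wpart.
case: eqP => e1; last by rewrite mul0r.
case: eqP => e2; last by rewrite mulr0.
by case: E; rewrite (wtD a b i k) e1 e2.
Qed.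

Lemma wtopM d e f g : wtop d f -> wtop e g ->
  wtop (d + e) (f * g) /\ wpart (d + e) (f * g) = wpart d f * wpart e g.
Proof.
move=> [lf nf] [lg ng]; have [l E] := wpartM lf lg.
by split=> //; split=> //; rewrite E mulf_neq0.
Qed.

Lemma wtop_attained d f : wtop d f -> exists2 m, m \in bsupp f & wt m = d.
Proof.
move=> [_ nf]; apply: contrapT => nex; case/eqP: nf; apply: bpolyP => a b.
rewrite bcoef_wpart {2}/bcoef !coef0; case: eqP => // E.
apply/eqP; apply: contrapT => /negP nz; apply: nex; exists (a, b) => //.
by rewrite mem_bsupp.
Qed.

(** Maximality tested with the order of [C] agrees with that of integer weights on the support;
    elsewhere both coefficients are zero. *)
Lemma initial_form_wpart d f : wtop d f -> initial_form f p%:~R q%:~R = wpart d f.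
Proof.
move=> tf; have [lf _] := tf.
have wtE a b : p%:~R * a%:R + q%:~R * b%:R = (wt (a, b))%:~R :> C.
  by rewrite /wt rmorphD !rmorphM /=.
have [m mf md] := wtop_attained tf.
have wmaxE a b : (a, b) \in bsupp f -> is_wmax f p%:~R q%:~R a b = (wt (a, b) == d).
  move=> abf; apply/forallP/eqP => [H|E a'].
    have [] := @bcoef_bounds f m.1 m.2; first by rewrite -mem_bsupp.
    move=> lt1 lt2; have /forallP /(_ (Ordinal lt2)) /= := H (Ordinal lt1).
    rewrite -mem_bsupp mf /= !wtE ler_int -surjective_pairing md => le.
    by apply: le_anti; rewrite le lf.
  apply/forallP => b'; apply/implyP => nz.
  by rewrite !wtE ler_int E lf // mem_bsupp.
apply: bpolyP => a b; rewrite bcoef_wpart.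
have [nz|z] := boolP ((a, b) \in bsupp f).
  rewrite -wmaxE //; move: nz; rewrite mem_bsupp /= => nz.
  have [lta _] := bcoef_bounds nz.
  rewrite {1}/bcoef coef_poly lta coef_poly.
  case: ltnP => // le; by rewrite /bcoef (nth_default _ le) eqxx in nz.
have {}z : bcoef f a b = 0 by apply/eqP; rewrite mem_bsupp negbK in z.
rewrite z if_same {1}/bcoef coef_poly; case: ltnP => _; last by rewrite coef0.
by rewrite coef_poly; case: ltnP => _ //; rewrite z if_same.
Qed.

Lemma initial_formM f g : f != 0 -> g != 0 ->
  initial_form (f * g) p%:~R q%:~R =
  initial_form f p%:~R q%:~R * initial_form g p%:~R q%:~R.
Proof.
move=> /wtop_exists [d tf] /wtop_exists [e tg].
have [tfg E] := wtopM tf tg.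
by rewrite !(initial_form_wpart tf, initial_form_wpart tg, initial_form_wpart tfg).
Qed.

End Weight.
End Bipoly.

(** * Valuation rings over an algebraically closed field *)

Section Valuation.
Variables (C : closedFieldType) (K : fieldType) (j : {rmorphism C -> K}).
Implicit Types (O A : K -> Prop) (a b u z : K).

(** [P] splits into linear factors over [C], and one of them falls into [I] because [I] is prime and
    omits the nonzero constants. With [I] zero, or the maximal ideal of a valuation ring, this says
    that elements of [K], or of the residue field, algebraic over [C] are constants. *)
Lemma closed_root_prime (I : K -> Prop) (P : {poly C}) u :
  (forall a b, I (a * b) -> I a \/ I b) -> (forall c, c != 0 -> ~ I (j c)) ->
  P != 0 -> I (map_poly j P).[u] -> exists l, I (u - j l).
Proof.
move=> Ip Ij Pn0; have [r {1}->] := closed_field_poly_normal P.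
rewrite map_polyZ hornerZ rmorph_prod horner_prod => /Ip [|].
  by move/Ij => []; rewrite lead_coef_eq0.
elim: r => [|l r IH]; first by rewrite big_nil -(rmorph1 j) => /Ij []; rewrite oner_eq0.
rewrite big_cons => /Ip [H|/IH //]; exists l.
by move: H; rewrite /= rmorphB /= map_polyX map_polyC hornerXsubC.
Qed.

Lemma algebraic_in_closed (P : {poly C}) u :
  P != 0 -> (map_poly j P).[u] = 0 -> exists c, u = j c.
Proof.
move=> Pn0 Pu.
have [||l /eqP] := @closed_root_prime (fun a => a = 0) P u _ _ Pn0 Pu.
- by move=> a b /eqP; rewrite mulf_eq0 => /orP[] /eqP ->; [left|right].
- by move=> c cn0 /eqP; rewrite fmorph_eq0 (negPf cn0).
by rewrite subr_eq0 => /eqP ->; exists l.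
Qed.

Definition subring_over A := [/\ forall c, A (j c),
  forall a b, A a -> A b -> A (a + b) & forall a b, A a -> A b -> A (a * b)].

Definition valring O := subring_over O /\ forall a, O a \/ O a^-1.

(** * Adjoining an element to a subring *)

Section Adjoin.
Variables (A : K -> Prop) (HA : subring_over A).

(** The bound [n] on the powers of [z] is recorded because the induction of [adj_both] runs on
    it. *)
Definition adj z n a :=
  exists2 c : nat -> K, forall i, A (c i) & a = \sum_(i < n) c i * z ^+ i.

Lemma sub0_over : A 0. Proof. by rewrite -(rmorph0 j); case: HA. Qed.

Lemma adjD z n a b : adj z n a -> adj z n b -> adj z n (a + b).
Proof.
case: HA => _ AD _ [c Ac ->] [e Ae ->].
exists (fun i => c i + e i); first by move=> i; exact: AD.
by rewrite -big_split; apply: eq_bigr => i _; rewrite mulrDl.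
Qed.

Lemma adjZ z n a b : A a -> adj z n b -> adj z n (a * b).
Proof.
case: HA => _ _ AM Aa [e Ae ->]; exists (fun i => a * e i); first by move=> i; exact: AM.
by rewrite mulr_sumr; apply: eq_bigr => i _; rewrite mulrA.
Qed.

Lemma adjX z n k : (k < n)%N -> adj z n (z ^+ k).
Proof.
move=> lt; exists (fun i => (i == k)%:R).
  by move=> i; rewrite -(rmorph_nat j); case: HA.
rewrite (bigD1 (Ordinal lt)) //= eqxx mul1r big1 ?addr0 // => i.
by rewrite -val_eqE /= => /negPf ->; rewrite mul0r.
Qed.

Lemma adj0 z n : adj z n 0.
Proof.
exists (fun=> 0); first by move=> _; exact: sub0_over.
by rewrite big1 // => i _; rewrite mul0r.
Qed.

Lemma adj_sum z n (I : Type) (r : seq I) (P : pred I) (F : I -> K) :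
  (forall i, P i -> adj z n (F i)) -> adj z n (\sum_(i <- r | P i) F i).
Proof.
by move=> H; apply: (big_ind (adj z n)) => //; [exact: adj0|exact: adjD].
Qed.

Lemma adjW z n k a : (n <= k)%N -> adj z n a -> adj z k a.
Proof.
move=> le [c Ac ->]; apply: adj_sum => i _; apply: adjZ; first exact: Ac.
by apply: adjX; exact: leq_trans le.
Qed.

Lemma adj_base z n a : (0 < n)%N -> A a -> adj z n a.
Proof. by move=> lt Aa; rewrite -[a]mulr1 -(expr0 z); apply/adjZ/adjX. Qed.

Lemma adjM z n k a b : adj z n a -> adj z k b -> adj z (n + k) (a * b).
Proof.
move=> [c Ac ->] [e Ae ->]; rewrite mulr_suml; apply: adj_sum => i _.
rewrite mulr_sumr; apply: adj_sum => l _.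
have -> : c i * z ^+ i * (e l * z ^+ l) = c i * (e l * z ^+ (i + l)).
  by rewrite exprD; ring.
apply: adjZ; first exact: Ac.
apply: adjZ; first exact: Ae.
by apply: adjX; have := ltn_ord i; have := ltn_ord l; lia.
Qed.

Lemma adj_subring z : subring_over (fun a => exists n, adj z n a).
Proof.
case: (HA) => Aj AD AM; split.
- by move=> c; exists 1%N; apply: adj_base.
- move=> a b [n Ha] [k Hb]; exists (n + k)%N; apply: adjD.
  + apply: (adjW _ Ha); exact: leq_addr.
  + apply: (adjW _ Hb); exact: leq_addl.
- by move=> a b [n Ha] [k Hb]; exists (n + k)%N; apply: adjM.
Qed.

(* [t - b 0] is a combination of [1/z, ..., 1/z^(k-1)], hence multiplying the top
   monomial of [t] by it lowers the degree in [z]. *)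
Lemma adj_reduce t z n k : z != 0 -> t != 0 -> A t^-1 ->
  (k <= n.+2)%N -> adj z n.+2 t -> adj z^-1 k t -> adj z n.+1 t.
Proof.
move=> z0 t0 As le [c Ac Et] [b Ab Eb].
case: k => [|k] in le Eb *; first by rewrite Eb big_ord0 eqxx in t0.
case: (HA) => Aj AD AM.
have AN a : A a -> A (- a) by rewrite -mulN1r -(rmorph1 j) -rmorphN => ?; apply: AM.
have low : adj z n.+1 (z ^+ n.+1 * (t - b 0%N)).
  rewrite Eb big_ord_recl /= expr0 mulr1 addrAC subrr add0r mulr_sumr.
  apply: adj_sum => i _; rewrite mulrCA; apply: adjZ; first exact: Ab.
  rewrite exprVn -expfB_cond ?(negPf z0) ?add0n /bump /= ?add1n.
    by apply: adjX; have := ltn_ord i; lia.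
  by have := ltn_ord i; lia.
(* The top term of [t] is split in the proportions [t^-1 * b 0] and [1 - t^-1 * b 0]. The first
   share is rewritten as top term equals [t] minus the lower terms; the second is a multiple of the
   element bounded in [low]. *)
have -> : t = b 0%N + ((1 - t^-1 * b 0%N) * (\sum_(i < n.+1) c i * z ^+ i)
                     + t^-1 * c n.+1 * (z ^+ n.+1 * (t - b 0%N))).
  have Es : \sum_(i < n.+1) c i * z ^+ i = t - c n.+1 * z ^+ n.+1.
    by rewrite [t in RHS]Et [in RHS]big_ord_recr /= addrK.
  by rewrite Es; field.
apply: adjD; first exact: adj_base.
apply: adjD; apply: adjZ => //; first 1 last.
- by exists c.
- exact: AM.
by apply: (AD); [rewrite -(rmorph1 j)|apply/AN/AM].
Qed.

(** As [z] and [z^-1] play symmetric roles, the longer expression may be taken in [z]; [adj_reduce]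
    shortens it until a single coefficient in [A] is left. *)
Lemma adj_both t z n k : t != 0 -> A t^-1 -> z != 0 ->
  adj z n t -> adj z^-1 k t -> A t.
Proof.
move=> t0 As; move: {2}(n + k)%N (leqnn (n + k)%N) => N.
elim: N z n k => [|N IH] z n k le z0.
  move: le; rewrite leqn0 addn_eq0 => /andP[/eqP -> _].
  by move=> [c _ Et]; rewrite Et big_ord0 eqxx in t0.
wlog lekn : z n k le z0 / (k <= n)%N.
  move=> W; have [/W|] := leqP k n; first exact.
  move=> /ltnW lenk H1 H2; apply: (W z^-1 k n); rewrite ?invrK ?invr_eq0 //.
  by rewrite addnC.
case: n => [|[|n]] in le lekn *.
- by move=> [c _ Et]; rewrite Et big_ord0 eqxx in t0.
- by move=> [c Ac ->] _; rewrite big_ord_recl big_ord0 addr0 mulr1.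
move=> H1 H2; apply: (IH z n.+1 k) => //.
exact: adj_reduce H1 H2.
Qed.

End Adjoin.

(** Zorn's lemma gives a maximal ring among those containing [C] and [t^-1] but not [t]. If it
    omitted both [a] and [a^-1], adjoining either one would capture [t], and [adj_both] would put
    [t] in the ring itself. *)
Lemma valring_avoiding t : (forall c, t <> j c) -> exists2 O, valring O & ~ O t.
Proof.
move=> tC; have t0 : t != 0 by apply/eqP=> e; apply: (tC 0); rewrite rmorph0.
pose good A := [/\ subring_over A, A t^-1 & ~ A t].
have g0 : good (fun a => exists P : {poly C}, a = (map_poly j P).[t^-1]).
  split; first split.
  - by move=> c; exists c%:P; rewrite map_polyC hornerC.
  - by move=> _ _ [P ->] [Q ->]; exists (P + Q); rewrite rmorphD hornerD.
  - by move=> _ _ [P ->] [Q ->]; exists (P * Q); rewrite rmorphM hornerM.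
  - by exists 'X; rewrite map_polyX hornerX.
  move=> [P E].
  (* If [t = P(t^-1)], then [t^-1] is a root of [X P - 1], whose constant coefficient is [-1]; so
     [t^-1] is a constant. *)
  have [||c Ec] := @algebraic_in_closed ('X * P - 1) t^-1.
  - apply/eqP => /(congr1 (fun p : {poly C} => p`_0)) /eqP.
    by rewrite coefB coefXM coef1 coef0 sub0r oppr_eq0 oner_eq0.
  - rewrite rmorphB rmorphM rmorph1 /= map_polyX !hornerE -E mulVf // subrr //.
  by apply: (tC c^-1); rewrite fmorphV -Ec invrK.
pose R (A B : {A | good A}) : bool := `[< forall a, sval A a -> sval B a >].
have [|||[O [HO Os Ot]] max] := @ZL_preorder _ (exist good _ g0) R.
- by move=> A; apply/asboolP.
- by move=> A B D /asboolP AB /asboolP BD; apply/asboolP=> a /AB /BD.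
(* The empty chain is bounded by [C[t^-1]], any other chain by its union. *)
- move=> F tot; have [[B0 FB0]|nF] := pselect (exists B, F B); last first.
    by exists (exist good _ g0) => B FB; case: nF; exists B.
  suff gU : good (fun a => exists2 B, F B & sval B a).
    by exists (exist good _ gU) => B FB; apply/asboolP=> a Ba; exists B.
  have pair a b (B D : {A | good A}) : F B -> F D -> sval B a -> sval D b ->
      exists2 E, F E & sval E a /\ sval E b.
    move=> FB FD Ba Db; case: (tot _ _ FB FD) => /asboolP S.
      by exists D => //; split=> //; exact: S.
    by exists B => //; split=> //; exact: S.
  split; first split.
  - by move=> c; exists B0 => //; case: (svalP B0) => -[].
  - move=> a b [B FB Ba] [D FD Db]; have [E FE [Ea Eb]] := pair _ _ _ _ FB FD Ba Db.
    by exists E => //; case: (svalP E) => -[_ ED _] _ _; exact: ED.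
  - move=> a b [B FB Ba] [D FD Db]; have [E FE [Ea Eb]] := pair _ _ _ _ FB FD Ba Db.
    by exists E => //; case: (svalP E) => -[_ _ EM] _ _; exact: EM.
  - by exists B0 => //; case: (svalP B0).
  - by case=> B _; case: (svalP B).
exists O => //; split=> // a.
have ext z : ~ O z -> exists n, adj O z n t.
  move=> Oz; apply: contrapT => nt.
  have sub b : O b -> exists n, adj O z n b by exists 1%N; apply: adj_base.
  have gz : good (fun b => exists n, adj O z n b).
    by split=> //; [exact: adj_subring|exact: sub].
  have := max (exist good _ gz); rewrite /R /= => H; apply: Oz.
  have /asboolP := H (introT (asboolP _) sub); apply.
  by exists 2%N; rewrite -[z]expr1; apply: adjX.
have [e|a0] := eqVneq a 0; first by left; rewrite e; exact: sub0_over HO.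
have [Oa|/ext [n H1]] := pselect (O a); first by left.
have [Oa|/ext [k H2]] := pselect (O a^-1); first by right.
by exfalso; apply: (Ot); exact: (adj_both HO t0 Os a0 H1 H2).
Qed.

(** * The maximal ideal and the units of a valuation ring *)

Section MaxIdeal.
Variables (O : K -> Prop) (HO : valring O).

Let Oj c : O (j c). Proof. by case: HO => -[]. Qed.
Let OD a b : O a -> O b -> O (a + b). Proof. by case: HO => -[_ H _] _; exact: H. Qed.
Let OM a b : O a -> O b -> O (a * b). Proof. by case: HO => -[_ _ H] _; exact: H. Qed.
Let O1 : O 1. Proof. by rewrite -(rmorph1 j). Qed.
Let OX a n : O a -> O (a ^+ n).
Proof. by move=> Oa; elim: n => [|n IH]; rewrite ?expr0 ?exprS //; exact: OM. Qed.

(* Since [0^-1 = 0] lies in [O], the second disjunct forces [a != 0]. *)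
Definition maxid a := a = 0 \/ ~ O a^-1.

Lemma maxid_sub a : maxid a -> O a.
Proof.
case=> [->|]; first by rewrite -(rmorph0 j).
by case: HO => _ /(_ a) [].
Qed.

Lemma maxidM a b : O a -> maxid b -> maxid (a * b).
Proof.
move=> Oa [->|Ob]; first by left; rewrite mulr0.
have [->|a0] := eqVneq a 0; first by left; rewrite mul0r.
right=> H; apply: Ob; have -> : b^-1 = a * (a * b)^-1 by rewrite invfM mulVKf.
exact: OM.
Qed.

Lemma maxidD a b : maxid a -> maxid b -> maxid (a + b).
Proof.
move=> Ma Mb; have [->|a0] := eqVneq a 0; first by rewrite add0r.
have [->|b0] := eqVneq b 0; first by rewrite addr0.
have [_ /(_ (a / b)) [H|]] := HO.
  have -> : a + b = (a / b + 1) * b by rewrite mulrDl divfK // mul1r.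
  by apply: maxidM => //; exact: OD.
rewrite invfM invrK mulrC => H.
have -> : a + b = (1 + b / a) * a by rewrite mulrDl divfK // mul1r.
by apply: maxidM => //; exact: OD.
Qed.

Lemma maxidN a : maxid a -> maxid (- a).
Proof.
by move=> Ma; rewrite -mulN1r; apply: maxidM => //; rewrite -(rmorph1 j) -rmorphN.
Qed.

Lemma maxid0 : maxid 0. Proof. by left. Qed.

Lemma maxid_sum (I : Type) (r : seq I) (P : pred I) (F : I -> K) :
  (forall i, P i -> maxid (F i)) -> maxid (\sum_(i <- r | P i) F i).
Proof.
by move=> H; apply: (big_ind maxid) => //; [exact: maxid0|exact: maxidD].
Qed.

Lemma maxid_prime a b : maxid (a * b) -> maxid a \/ maxid b.
Proof.
move=> Mab; apply: contrapT => /not_orP [Ha Hb].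
have Ua : O a^-1 by apply: contrapT => ?; apply: Ha; right.
have Ub : O b^-1 by apply: contrapT => ?; apply: Hb; right.
case: Mab => [/eqP|]; last by rewrite invfM; apply; exact: OM.
by rewrite mulf_eq0 => /orP[] /eqP e; [apply: Ha|apply: Hb]; left.
Qed.

Lemma maxid_closed c : maxid (j c) -> c = 0.
Proof.
case=> [/eqP|[]]; first by rewrite fmorph_eq0 => /eqP.
by rewrite -fmorphV.
Qed.

Lemma nmaxid_unit a : ~ maxid a -> a != 0 /\ O a^-1.
Proof.
move=> H; split; first by apply/eqP=> ?; apply: H; left.
by apply: contrapT => ?; apply: H; right.
Qed.

Definition vunit a := [/\ a != 0, O a & O a^-1].

Lemma vunitXz a (n : int) : vunit a -> vunit (a ^ n).
Proof.
case=> a0 Oa Ob.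
have H k : O (a ^ k) by case: k => k; [|rewrite NegzE -exprz_inv]; exact: OX.
by split; [rewrite expfz_neq0|exact: H|rewrite invr_expz; exact: H].
Qed.

(** One of [a], [a^-1] lies in [O], and the other is a power of it times a unit. *)
Lemma vunit_root a (n : int) : n != 0 -> vunit (a ^ n) -> vunit a.
Proof.
move=> n0 U.
have {n n0 U} [n U] : exists n, vunit (a ^+ n.+1).
  case: n n0 U => [[//|n] _ U|n _ [an0 U1 U2]]; first by exists n.
  exists n; move: an0 U1 U2; rewrite NegzE -exprz_inv -exprnP exprVn invrK.
  by rewrite invr_eq0; split.
case: U => an0 U1 U2; have a0 : a != 0 by rewrite expf_eq0 /= in an0.
case: HO => _ /(_ a) [Oa|Oa]; split=> //.
  have -> : a^-1 = a ^+ n / a ^+ n.+1 by rewrite exprS invfM mulrCA divff ?mulr1 ?expf_neq0.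
  by apply: OM => //; exact: OX.
have -> : a = a^-1 ^+ n * a ^+ n.+1.
  by rewrite exprS exprVn mulrCA mulVf ?mulr1 ?expf_neq0.
by apply: OM => //; exact: OX.
Qed.

Lemma maxid_expz_sub u l (n : int) : vunit u -> l != 0 -> maxid (u - j l) ->
  maxid (u ^ n - j (l ^ n)).
Proof.
move=> Uu l0 M; have [u0 Ou Ov] := Uu.
have nat_case (k : nat) : maxid (u ^+ k - j l ^+ k).
  by rewrite subrXX mulrC; apply: maxidM => //;
    apply: (big_ind O) => //; rewrite -?(rmorph0 j) // => i _;
    rewrite -rmorphXn; apply: OM => //; exact: OX.
case: n => n; first by rewrite -!exprnP rmorphXn.
rewrite NegzE -!exprnN fmorphV rmorphXn /=.
have jl0 : j l != 0 by rewrite fmorph_eq0.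
have -> : u ^- n.+1 - j l ^- n.+1 =
    - (u ^- n.+1 * j (l ^- n.+1)) * (u ^+ n.+1 - j l ^+ n.+1).
  by rewrite fmorphV rmorphXn /=; field; rewrite !expf_neq0.
apply: maxidM => //; rewrite -mulN1r; apply: OM; first by rewrite -(rmorph1 j) -rmorphN.
by apply: OM => //; rewrite -exprVn; exact: OX.
Qed.

(** A term that strictly dominates all the others cannot be cancelled, so a dominant term is tied
    with another one. *)
Lemma tie_in_zero_sum (I : eqType) (s : seq I) (c : I -> C) (F : I -> K) :
  uniq s -> s != [::] -> (forall i, i \in s -> c i != 0 /\ F i != 0) ->
  \sum_(i <- s) j (c i) * F i = 0 ->
  exists i k, [/\ i \in s, k \in s, i != k & vunit (F i / F k)].
Proof.
move=> us s0 nz E.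
have [k ks kmax] : exists2 k, k \in s & forall i, i \in s -> O (F i / F k).
  case: s s0 nz {us E} => [//|i0 s] _ nz; elim: s i0 nz => [|i1 s IH] i0 nz.
    exists i0; rewrite ?mem_head // => i; rewrite inE => /eqP ->.
    by rewrite divff //; case: (nz i0 (mem_head _ _)).
  have [k ks kmax] := IH i1 (fun i H => nz i (@mem_behead _ (i0 :: i1 :: s) _ H)).
  have [_ Fi0] := nz i0 (mem_head _ _).
  have [_ Fk] := nz k (@mem_behead _ (i0 :: i1 :: s) _ ks).
  have [_ /(_ (F i0 / F k)) [H|H]] := HO.
    exists k; first by rewrite inE ks orbT.
    by move=> i; rewrite inE => /orP[/eqP -> //|/kmax].
  exists i0; first by rewrite mem_head.
  move=> i; rewrite inE => /orP[/eqP ->|/kmax Hi]; first by rewrite divff.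
  have -> : F i / F i0 = F i / F k * (F i0 / F k)^-1 by field; rewrite Fk Fi0.
  exact: OM.
apply: contrapT => H.
have [ck0 Fk0] := nz k ks.
suff /maxid_closed e : maxid (j (c k)) by rewrite e eqxx in ck0.
(* After division by the dominant term [F k], the constant [c k] is minus a combination of ratios
   which all lie in the maximal ideal when there is no tie. *)
have -> : j (c k) = - \sum_(i <- s | i != k) j (c i) * (F i / F k).
  apply/eqP; rewrite -addr_eq0 -[j (c k)]mulr1 -(divff Fk0).
  rewrite -(bigD1_seq k ks us (F := fun i => j (c i) * (F i / F k))) /=.
  by under eq_bigr do rewrite mulrA; rewrite -mulr_suml E mul0r.
apply: maxidN; rewrite big_seq_cond; apply: maxid_sum => i /andP[si ik].
apply: maxidM => //; apply: contrapT => /nmaxid_unit [n0 Oi]; apply: H.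
by exists i, k; split=> //; split=> //; exact: kmax.
Qed.

End MaxIdeal.
End Valuation.

(** * Zeros and generic points *)

Section Null.
Variable C : numClosedFieldType.
Implicit Types (f g h : {poly {poly C}}).

Lemma closed_field_root (P : {poly C}) : (size P != 1)%N -> exists x, P.[x] = 0.
Proof. by move=> /closed_rootP [x /rootP]; exists x. Qed.

Lemma exists_nonroot (P : {poly C}) : P != 0 -> exists x, P.[x] != 0.
Proof.
move=> P0; apply: contrapT => H.
have all0 (n : nat) : root P n%:R.
  by apply/rootP/eqP; apply: contrapT => /negP ?; apply: H; exists n%:R.
have := @max_poly_roots _ P [seq n%:R | n <- iota 0 (size P)] P0.
rewrite size_map size_iota ltnn => F; suff : false by []; apply: F.
  by apply/allP=> _ /mapP[n _ ->].
rewrite map_inj_uniq ?iota_uniq // => a b /eqP.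
by rewrite eqr_nat => /eqP.
Qed.

(** Geometrically, the restriction of [f] to the horizontal line of height [y]. *)
Definition slice f (y : C) : {poly C} := map_poly (horner_eval y) f.

Lemma beval_slice f x y : beval f x y = (slice f y).[x].
Proof.
rewrite /beval /slice.
have -> : x = horner_eval y x%:P by rewrite /horner_eval hornerC.
by rewrite horner_map /horner_eval hornerC.
Qed.

Lemma sliceM f g y : slice (f * g) y = slice f y * slice g y.
Proof. exact: rmorphM. Qed.

(** The two restrictions to the line are coprime in [C[X]]. Their Bezout identity, lifted with
    coefficients free of [Y], fails by a polynomial vanishing on the line, hence by a multiple of
    [Y - y]. *)
Lemma slice_coprime_bezout g h y :
  ~ (exists x, beval g x y = 0 /\ beval h x y = 0) ->
  exists u v w, u * g + v * h = 1 + ('X - y%:P)%:P * w.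
Proof.
move=> nz; have : coprimep (slice g y) (slice h y).
  rewrite /coprimep; apply: contrapT => /negP /closed_rootP [x].
  rewrite root_gcd => /andP[/rootP xg /rootP xh]; apply: nz; exists x.
  by rewrite !beval_slice.
case/Bezout_eq1_coprimepP => -[u v] /= E.
have div f : slice f y = 0 -> exists w, f = ('X - y%:P)%:P * w.
  move=> E0; exists (map_poly (fun P => P %/ ('X - y%:P)) f).
  apply/polyP=> a; rewrite coefCM coef_map_id0 ?div0p // mulrC divpK //.
  by rewrite dvdp_XsubCl; apply/rootP; have := congr1 (fun P : {poly C} => P`_a) E0;
    rewrite coef_map coef0.
have sl (P : {poly C}) : slice (map_poly polyC P) y = P.
  by apply/polyP=> a; rewrite coef_map coef_map /= /horner_eval hornerC.
pose U := map_poly polyC u; pose V := map_poly polyC v.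
have [w Ew] : exists w, U * g + V * h - 1 = ('X - y%:P)%:P * w.
  by apply: div; rewrite /slice rmorphB rmorphD !rmorphM rmorph1 /=
    -!/(slice _ y) !sl E subrr.
by exists U, V, w; rewrite -Ew [RHS]addrC subrK.
Qed.

(** The roots of [P] are removed one by one: from [u g + v h = (Y - z) Q] and
    [a g + b h = 1 + (Y - z) w] follows [Q = Q (a g + b h) - w (u g + v h)]. *)
Lemma bezout_of_univariate g h (P : {poly C}) u v : P != 0 ->
  u * g + v * h = P%:P ->
  ~ (exists x y, beval g x y = 0 /\ beval h x y = 0) ->
  exists u v, u * g + v * h = 1.
Proof.
move=> P0 E nz; have [r EP] := closed_field_poly_normal P.
have lc0 : lead_coef P != 0 by rewrite lead_coef_eq0.
have {E} : exists u v, u * g + v * h = (\prod_(z <- r) ('X - z%:P))%:P.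
  exists ((lead_coef P)^-1%:P%:P * u), ((lead_coef P)^-1%:P%:P * v).
  rewrite -!mulrA -mulrDr E -polyCM mul_polyC; congr (_%:P).
  by rewrite {2}EP scalerA mulVf ?scale1r.
elim: r {EP P P0 lc0 u v} => [|z r IH] [u [v]].
  by rewrite big_nil => E; exists u, v.
rewrite big_cons rmorphM /= => E; apply: IH.
have [|a [b [w Ew]]] := @slice_coprime_bezout g h z.
  by case=> x H; apply: nz; exists x, z.
set Q := (\prod_(_ <- _) _)%:P in E *.
exists (Q * a - w * u), (Q * b - w * v).
have -> : (Q * a - w * u) * g + (Q * b - w * v) * h =
  Q * (a * g + b * h) - w * (u * g + v * h) by ring.
by rewrite E Ew; ring.
Qed.

(** The resultant in [X] is a polynomial in [Y] inside the ideal of [g] and [h]. If it vanishes, a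
    common factor [d] of positive degree in [X] has a zero on almost every line. *)
Lemma nullstellensatz2 g h : g != 0 -> h != 0 ->
  ~ (exists x y, beval g x y = 0 /\ beval h x y = 0) ->
  exists u v, u * g + v * h = 1.
Proof.
move=> g0 h0 nz.
have [sg|sg] := leqP (size g) 1.
  have E := size1_polyC sg.
  apply: (@bezout_of_univariate _ _ g`_0 1 0) => //.
    by apply: contraNneq g0 => e; rewrite E e.
  by rewrite mul1r mul0r addr0.
have [sh|sh] := leqP (size h) 1.
  have E := size1_polyC sh.
  apply: (@bezout_of_univariate _ _ h`_0 0 1) => //.
    by apply: contraNneq h0 => e; rewrite E e.
  by rewrite mul1r mul0r add0r.
have [[u v] _ E] := resultant_in_ideal sg sh.
have [|R0] := eqVneq (resultant g h) 0; last first.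
  exact: (bezout_of_univariate R0 (esym E)).
move/eqP; rewrite resultant_eq0 => sd; case: nz.
pose d : {poly {poly C}} := Pdiv.Idomain.gcdp g h.
rewrite -/d in sd.
have /Pdiv.Idomain.dvdpP [[c a] /= c0 Ec] := Pdiv.Idomain.dvdp_gcdl g h.
have /Pdiv.Idomain.dvdpP [[c' a'] /= c0' Ec'] := Pdiv.Idomain.dvdp_gcdr g h.
(* At this [y] the leading coefficient keeps [d] nonconstant, and the multipliers [c], [c'] of the
   pseudo-divisions can be cancelled. *)
have [|y] := @exists_nonroot (c * c' * lead_coef d).
  by rewrite !mulf_neq0 // lead_coef_eq0 -size_poly_gt0 (leq_trans _ sd).
rewrite !hornerM !mulf_eq0 !negb_or => /andP[/andP[cy cy'] ly].
have [x Ex] : exists x, (slice d y).[x] = 0.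
  apply: closed_field_root; rewrite /slice size_map_poly_id0 //.
  by apply/eqP=> e; rewrite e in sd.
exists x, y; rewrite !beval_slice.
have step (e : {poly C}) (b f : {poly {poly C}}) :
    e *: f = b * d -> e.[y] != 0 -> (slice f y).[x] = 0.
  move=> Ef ey; apply/eqP.
  have /eqP : (slice (e *: f) y).[x] = (slice (b * d) y).[x] by rewrite Ef.
  rewrite -mul_polyC !sliceM !hornerM Ex mulr0 mulf_eq0.
  by rewrite {1}/slice map_polyC hornerC /= /horner_eval (negPf ey).
by split; [exact: step Ec cy|exact: step Ec' cy'].
Qed.

(** [P] is not a monomial, so removing the largest power of [X] leaves a nonconstant polynomial that
    does not vanish at zero. *)
Lemma nonzero_root (P : {poly C}) a b : a != b -> P`_a != 0 -> P`_b != 0 ->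
  exists2 x, x != 0 & P.[x] = 0.
Proof.
move=> ab Pa Pb; have P0 : P != 0 by apply: contraNneq Pa => ->; rewrite coef0.
have [k [Q Q0 E]] := multiplicity_XsubC P 0.
move: Q0; rewrite P0 /= => Q0; move: E; rewrite subr0 => E.
have [s1|/closed_field_root [x Qx]] := boolP (size Q == 1)%N.
  have [c c0 Ec] := size_poly1P _ s1.
  have co n : P`_n != 0 -> n = k.
    by rewrite E Ec coefCM coefXn; case: (n =P k) => // _; rewrite mulr0 eqxx.
  by move: ab; rewrite (co _ Pa) (co _ Pb) eqxx.
exists x; last by rewrite E hornerM Qx mul0r.
by apply: contraNneq Q0 => <-; apply/rootP.
Qed.

(** If two exponents of [X] occur in [f], its restriction to a general line has two terms, hence a
    nonzero root. Otherwise [f] is a power of [X] times a polynomial in [Y] with two terms. *)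
Lemma torus_zero f m n : m != n -> m \in bsupp f -> n \in bsupp f ->
  exists x y, [/\ x != 0, y != 0 & beval f x y = 0].
Proof.
case: m n => [a b] [c d] mn; rewrite !mem_bsupp /= => fm fn.
have nz (i k : nat) : bcoef f i k != 0 -> f`_i != 0.
  by apply: contraNneq => e; rewrite /bcoef e coef0.
have [e|ac] := eqVneq a c.
  have bd : b != d by apply: contraNneq mn => ->; rewrite e.
  rewrite -e in fn.
  have [y y0 Ey] := nonzero_root bd fm fn.
  have [[i [ia fi]]|H] := pselect (exists i, i != a /\ f`_i != 0).
    have [|z] := @exists_nonroot ('X * f`_a * f`_i).
      by rewrite !mulf_neq0 ?polyX_eq0 ?(nz _ _ fm).
    rewrite !hornerM hornerX !mulf_eq0 !negb_or => /andP[/andP[z0 fa'] fi'].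
    have [||x x0 Ex] := @nonzero_root (slice f z) i a ia; rewrite ?coef_map //.
    by exists x, z; split=> //; rewrite beval_slice.
  exists 1, y; split=> //; first exact: oner_neq0.
  rewrite beval_slice (_ : slice f y = 0) ?horner0 //; apply/polyP=> i.
  rewrite coef_map coef0 /= /horner_eval; have [->//|ia] := eqVneq i a.
  have [->|fi] := eqVneq f`_i 0; first by rewrite horner0.
  by case: H; exists i.
have [|z] := @exists_nonroot ('X * f`_a * f`_c).
  by rewrite !mulf_neq0 ?polyX_eq0 ?(nz _ _ fm) ?(nz _ _ fn).
rewrite !hornerM hornerX !mulf_eq0 !negb_or => /andP[/andP[z0 fa'] fi'].
have [||x x0 Ex] := @nonzero_root (slice f z) a c ac; rewrite ?coef_map //.
by exists x, z; split=> //; rewrite beval_slice.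
Qed.

Lemma irreducible_factor (F : fieldType) (P : {poly F}) : (1 < size P)%N ->
  exists2 Q, irreducible_poly Q & Q %| P.
Proof.
move: {2}(size P) (leqnn (size P)) => n; elim: n P => [|n IH] P le lt; first by lia.
have [irr|] := pselect (irreducible_poly P); first by exists P.
move=> nirr.
have [Q [sQ QP nQP]] : exists Q : {poly F}, [/\ size Q != 1%N, Q %| P & ~~ (Q %= P)].
  apply: contrapT => H; apply: nirr; split=> // Q sQ QP.
  by apply: contrapT => /negP ?; apply: H; exists Q.
have P0 : P != 0 by rewrite -size_poly_gt0 (leq_trans _ lt).
have Q0 : Q != 0 by apply: contraNneq P0 => e; move: QP; rewrite e dvd0p.
have ltQ : (size Q < size P)%N.
  by rewrite ltn_neqAle dvdp_leq // andbT dvdp_size_eqp.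
have gt1 : (1 < size Q)%N by move: sQ Q0; rewrite -size_poly_gt0; case: (size Q) => [|[]].
have [|S irrS SQ] := IH Q _ gt1; first by lia.
by exists S => //; exact: dvdp_trans QP.
Qed.

(** If [g] is free of [X], then [x] is transcendental and [y] a root of [g]. Otherwise [y] is the
    variable of a rational function field over [C], and [x] a root of an irreducible factor of [g]
    over that field. *)
Lemma generic_point g : pos_deg g ->
  exists (K : fieldType) (j : {rmorphism C -> K}) (x y : K),
    ev j x y g = 0 /\ ~ ((exists c, x = j c) /\ (exists c, y = j c)).
Proof.
move=> [a [b [ab gab]]].
pose F : fieldType := {fraction {poly C}}.
pose frac : {rmorphism {poly C} -> F} := @tofrac {poly C}.
pose i : {rmorphism C -> F} := frac \o polyC.
have iX c : frac 'X <> i c.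
  by move=> /eqP; rewrite /i /= tofrac_eq => /eqP /(congr1 (fun p : {poly C} => p`_1)) /eqP;
   rewrite coefX coefC oner_eq0.
have iev (P : {poly C}) : (map_poly i P).[frac 'X] = frac P.
  have -> : map_poly i P = map_poly frac (map_poly polyC P).
    by rewrite -map_poly_comp.
  by rewrite horner_map -[_.['X]]/(_ \Po 'X) comp_polyXr.
have [sg|sg] := leqP (size g) 1.
  have Eg := size1_polyC sg.
  have a0 : a = 0%N.
    by case: a ab gab => // a _; rewrite /bcoef Eg coefC coef0 eqxx.
  have [|y gy] := @closed_field_root g`_0.
    move: gab ab; rewrite /bcoef a0 add0n => gab b0.
    by apply: contraNneq gab => /eqP /size_poly1P [c _ ->];
      rewrite coefC -[b == _]negbK -lt0n b0.
  exists F, i, (frac 'X), (i y); split; last by case=> -[c /iX].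
  by rewrite /ev Eg map_polyC hornerC /= /horner_eval horner_map gy rmorph0.
have [|Q irrQ /dvdpP [S ES]] := @irreducible_factor F (map_poly frac g).
  rewrite size_map_inj_poly ?rmorph0 // => P Q /eqP.
  by rewrite tofrac_eq => /eqP.
have [L _ [z /rootP rz _]] := irredp_FAdjoin irrQ.
pose k : {rmorphism C -> L} := in_alg L \o i.
exists L, k, z, (in_alg L (frac 'X)); split.
  have Ef : map_poly (horner_eval (in_alg L (frac 'X)) \o map_poly k) g =
            map_poly (in_alg L) (map_poly frac g).
    rewrite -map_poly_comp; apply: eq_map_poly => P /=.
    rewrite /horner_eval (map_poly_comp (in_alg L) i) horner_map /=.
    by rewrite iev.
  by rewrite /ev Ef ES rmorphM hornerM rz mulr0.
by case=> _ [c /fmorph_inj /iX].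
Qed.

End Null.

(** * The weight and the residual point of a place at infinity *)

(** The Bezout coefficients complete the primitive vector [(e1, e2)] to a unimodular matrix, which
    serves as a monomial change of coordinates. *)
Lemma primitive_multiple (d1 d2 : int) : (d1 != 0) || (d2 != 0) ->
  exists D e1 e2 n1 n2 : int,
    [/\ D != 0, d1 = e1 * D, d2 = e2 * D & n1 * e1 + n2 * e2 = 1].
Proof.
move=> nz; have [n1 [n2 E]] := Bezoutz d1 d2.
have D0 : gcdz d1 d2 != 0 by rewrite gcdz_eq0 negb_and.
have [/dvdzP [e1 E1] /dvdzP [e2 E2]] := (dvdz_gcdl d1 d2, dvdz_gcdr d1 d2).
move: (gcdz d1 d2) D0 E E1 E2 => D D0 E E1 E2.
exists D, e1, e2, n1, n2; split=> //.
by apply: (mulIf D0); rewrite mul1r -[RHS]E E1 E2; ring.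
Qed.

Section Place.
Variables (C : numClosedFieldType) (K : fieldType) (j : {rmorphism C -> K}).
Variables (x y : K) (x0 : x != 0) (y0 : y != 0).
Implicit Types (f g h : {poly {poly C}}) (m : nat * nat).

(** The exponent vectors [(e1, e2)] and [(- n2, n1)] have determinant 1, hence form a basis of the
    lattice of exponents. *)
Lemma monomial_split (e1 e2 n1 n2 : int) m : n1 * e1 + n2 * e2 = 1 ->
  x ^+ m.1 * y ^+ m.2 =
  (x ^ e1 * y ^ e2) ^ (wt n1 n2 m) * (x ^ (- n2) * y ^ n1) ^ (wt (- e2) e1 m).
Proof.
move=> E; rewrite !exprnP !expfzMl !exprz_exp mulrACA -!expfzDr // /wt.
congr (x ^ _ * y ^ _).
  have -> : e1 * (n1 * m.1%:Z + n2 * m.2%:Z) + - n2 * (- e2 * m.1%:Z + e1 * m.2%:Z)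
          = (n1 * e1 + n2 * e2) * m.1%:Z by ring.
  by rewrite E mul1r.
have -> : e2 * (n1 * m.1%:Z + n2 * m.2%:Z) + n1 * (- e2 * m.1%:Z + e1 * m.2%:Z)
        = (n1 * e1 + n2 * e2) * m.2%:Z by ring.
by rewrite E mul1r.
Qed.

Lemma wt_inj (e1 e2 n1 n2 : int) m n : n1 * e1 + n2 * e2 = 1 ->
  wt n1 n2 m = wt n1 n2 n -> wt (- e2) e1 m = wt (- e2) e1 n -> m = n.
Proof.
case: m n => [a b] [c d]; rewrite /wt /= => E E1 E2.
have H1 : (n1 * e1 + n2 * e2) * (a%:Z - c%:Z) = 0.
  have -> : (n1 * e1 + n2 * e2) * (a%:Z - c%:Z) =
    e1 * ((n1 * a + n2 * b) - (n1 * c + n2 * d))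
    - n2 * ((- e2 * a + e1 * b) - (- e2 * c + e1 * d)) by ring.
  by rewrite E1 E2 !subrr !mulr0 subrr.
have H2 : (n1 * e1 + n2 * e2) * (b%:Z - d%:Z) = 0.
  have -> : (n1 * e1 + n2 * e2) * (b%:Z - d%:Z) =
    e2 * ((n1 * a + n2 * b) - (n1 * c + n2 * d))
    + n1 * ((- e2 * a + e1 * b) - (- e2 * c + e1 * d)) by ring.
  by rewrite E1 E2 !subrr !mulr0 addr0.
by move: H1 H2; rewrite E !mul1r => H1 H2; congr (_, _); lia.
Qed.

Variables (O : K -> Prop) (HO : valring j O) (Oxy : ~ (O x /\ O y)).
Variables (g : {poly {poly C}}) (g0 : g != 0) (gxy : ev j x y g = 0).

Let O1 : O 1. Proof. by rewrite -(rmorph1 j); case: HO => -[]. Qed.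

Lemma neg_power_maxid (t : K) (k : int) : ~ O t -> k < 0 -> maxid O (t ^ k).
Proof.
move=> Ot; case: k => // k _; rewrite NegzE -exprz_inv -exprnP exprSr.
have Mt : maxid O t^-1 by right; rewrite invrK.
apply: (maxidM HO) => //; elim: k => [|k IH]; first by rewrite expr0.
by rewrite exprS; case: HO => -[_ _ OM] _; apply: OM => //; apply: (maxid_sub HO).
Qed.

(** As [g] vanishes at [(x, y)], two of its monomials have a unit as ratio. The exponent of the
    ratio is a multiple of a primitive vector, so the corresponding monomial is itself a unit. *)
Lemma primitive_tie : exists e1 e2 n1 n2 : int,
  [/\ n1 * e1 + n2 * e2 = 1, vunit O (x ^ e1 * y ^ e2) & ~ O (x ^ (- n2) * y ^ n1)].
Proof.
have [m [n [_ _ mn U]]] : exists m n, [/\ m \in bsupp g, n \in bsupp g, m != n &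
    vunit O ((x ^+ m.1 * y ^+ m.2) / (x ^+ n.1 * y ^+ n.2))].
  apply: (tie_in_zero_sum HO (bsupp_uniq g) (bsupp_neq0 g0)
    (c := fun m => bcoef g m.1 m.2)).
    by move=> m; rewrite mem_bsupp => ->; rewrite mulf_neq0 ?expf_neq0.
  by rewrite -ev_bsupp.
pose d1 := m.1%:Z - n.1%:Z; pose d2 := m.2%:Z - n.2%:Z.
have [|D [e1 [e2 [n1 [n2 [D0 E1 E2 E]]]]]] := @primitive_multiple d1 d2.
  rewrite -negb_and; apply: contra mn => /andP[/eqP ? /eqP ?].
  by rewrite [m]surjective_pairing [n]surjective_pairing; apply/eqP; congr (_, _); lia.
have Uu : vunit O (x ^ e1 * y ^ e2).
  apply: (vunit_root HO D0); rewrite expfzMl !exprz_exp -E1 -E2.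
  rewrite /d1 /d2 !expfzDr // -!exprnN -!exprnP mulrACA.
  by move: U; rewrite invfM.
have [H|H] := pselect (O (x ^ (- n2) * y ^ n1)); last by exists e1, e2, n1, n2.
(* All signs are reversed, which inverts both coordinates. If the second one and its inverse were
   both in [O], every monomial, in particular [x] and [y], would be in [O]. *)
exists (- e1), (- e2), (- n1), (- n2); split.
- by rewrite !mulrNN.
- by have := vunitXz HO (-1) Uu; rewrite expfzMl !exprz_exp !mulrN1.
move=> H'; apply: Oxy.
have Ut : vunit O (x ^ (- n2) * y ^ n1).
  split=> //; first by rewrite mulf_neq0 ?expfz_neq0.
  by move: H'; rewrite invfM !invr_expz.
have OM a b : O a -> O b -> O (a * b) by case: HO => -[_ _ OM] _; apply: OM.
have split_O m' : O (x ^+ m'.1 * y ^+ m'.2).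
  by rewrite (monomial_split _ E); apply: OM; [case: (vunitXz HO (wt n1 n2 m') Uu)|
    case: (vunitXz HO (wt (- e2) e1 m') Ut)].
by split; [have := split_O (1, 0)%N|have := split_O (0, 1)%N];
  rewrite /= expr0 expr1 ?mulr1 ?mul1r.
Qed.

Section Residue.
Variables (e1 e2 n1 n2 : int) (E : n1 * e1 + n2 * e2 = 1).
Let u := x ^ e1 * y ^ e2.
Let t := x ^ (- n2) * y ^ n1.
Hypotheses (Uu : vunit O u) (Ot : ~ O t).

Let t0 : t != 0. Proof. by rewrite mulf_neq0 ?expfz_neq0. Qed.
Let u0 : u != 0. Proof. by case: Uu. Qed.

(** Terms of weight below [d] keep a negative power of [t] after the division, so they lie in the
    maximal ideal. *)
Lemma leading_part f d : wle (- e2) e1 d f ->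
  maxid O (ev j x y f / t ^ d - \sum_(m <- bsupp f | wt (- e2) e1 m == d)
                                j (bcoef f m.1 m.2) * u ^ (wt n1 n2 m)).
Proof.
move=> lf; rewrite ev_bsupp mulr_suml.
rewrite (bigID (fun m => wt (- e2) e1 m == d)) /= addrAC -sumrB.
have Oj c : O (j c) by case: HO => -[].
apply: (maxidD HO); last first.
  rewrite big_seq_cond; apply: (maxid_sum HO) => m /andP[mf md].
  rewrite (monomial_split _ E) -mulrA -mulrA -/u -/t mulrA invr_expz -expfzDr //.
  apply: (maxidM HO).
    by case: HO => -[_ _ OM] _; apply: OM => //; case: (vunitXz HO (wt n1 n2 m) Uu).
  by apply: neg_power_maxid => //; rewrite subr_lt0 lt_neqAle md lf.
apply: (maxid_sum HO) => m /eqP md.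
rewrite (monomial_split _ E) -/u -/t md mulrA mulfK ?expfz_neq0 // subrr.
exact: maxid0.
Qed.

(** Modulo the maximal ideal, the top part of [g] gives a Laurent polynomial over [C] with root [u].
    As [C] is closed, the residue of [u] lies in [C]; it is nonzero because [u] is a unit. *)
Lemma residue_exists : exists2 l : C, l != 0 & maxid O (u - j l).
Proof.
have [d tg] := wtop_exists (- e2) e1 g0; have [lg _] := tg.
have [m0 m0g m0d] := wtop_attained tg.
(* The shift by [N] makes all exponents nonnegative. *)
pose N : int := \sum_(m <- bsupp g) `|wt n1 n2 m|.
have leN m : m \in bsupp g -> 0 <= wt n1 n2 m + N.
  move=> mg; rewrite /N (big_rem m) //= addrA addr_ge0 ?sumr_ge0 //.
  by rewrite -(opprK (wt n1 n2 m)) addrC subr_ge0 normrN ler_norm.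
pose P : {poly C} := \sum_(m <- bsupp g | wt (- e2) e1 m == d)
  bcoef g m.1 m.2 *: 'X^(absz (wt n1 n2 m + N)%R).
have P0 : P != 0.
  (* By [wt_inj], monomials of the same weight [d] give different powers of the variable, so nothing
     cancels. *)
  suff : P`_(absz (wt n1 n2 m0 + N)%R) != 0 by apply: contraNneq => ->; rewrite coef0.
  rewrite coef_sum -big_filter (bigD1_seq m0) /=; last first.
  - exact/filter_uniq/bsupp_uniq.
  - by rewrite mem_filter m0d eqxx.
  rewrite big_seq_cond big1 ?addr0.
    by rewrite coefZ coefXn eqxx mulr1 -mem_bsupp.
  move=> m /andP[]; rewrite mem_filter => /andP[/eqP md mg] mm0.
  rewrite coefZ coefXn; case: eqP => [Ek|]; last by rewrite mulr0.
  case/eqP: mm0; apply: (wt_inj E); last by rewrite md m0d.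
  have := leN _ mg; have := leN _ m0g; lia.
have EP : (map_poly j P).[u] = u ^ N * \sum_(m <- bsupp g | wt (- e2) e1 m == d)
    j (bcoef g m.1 m.2) * u ^ (wt n1 n2 m).
  rewrite /P rmorph_sum horner_sum mulr_sumr big_seq_cond [RHS]big_seq_cond.
  apply: eq_bigr => m /andP[mg _].
  rewrite /= map_polyZ map_polyXn hornerZ hornerXn mulrCA -expfzDr // [N + _]addrC.
  by rewrite exprnP gez0_abs ?leN.
have MP : maxid O (map_poly j P).[u].
  rewrite EP; apply: (maxidM HO); first by case: (vunitXz HO N Uu).
  have := maxidN HO (leading_part lg); by rewrite gxy mul0r sub0r opprK.
have [||l Ml] := closed_root_prime _ _ P0 MP.
- exact: (maxid_prime HO).
- by move=> c c0 /(maxid_closed HO) /eqP; apply/negP.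
exists l => //; apply/eqP=> l0; move: Ml; rewrite l0 rmorph0 subr0.
by case: Uu => _ _ Ou [/eqP|//]; rewrite (negPf u0).
Qed.

(** At the point [(l ^ n1, l ^ n2)] a monomial [m] takes the value [l ^ (wt n1 n2 m)], the residue
    of its power of [u] in [leading_part]. *)
Lemma residue_wpart l f d : l != 0 -> maxid O (u - j l) -> wle (- e2) e1 d f ->
  maxid O (ev j x y f / t ^ d - j (beval (wpart (- e2) e1 d f) (l ^ n1) (l ^ n2))).
Proof.
move=> l0 Ml lf.
have := leading_part lf; set S := \sum_(_ <- _ | _) _ => M1.
have -> : ev j x y f / t ^ d - j (beval (wpart (- e2) e1 d f) (l ^ n1) (l ^ n2)) =
  (ev j x y f / t ^ d - S) + (S - j (beval (wpart (- e2) e1 d f) (l ^ n1) (l ^ n2))).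
  by rewrite addrA subrK.
apply: (maxidD HO) => //; rewrite beval_ev (@ev_wide _ _ _ _ _ _ (bsupp f)); last first.
- move=> m; rewrite !mem_bsupp bcoef_wpart -surjective_pairing.
  by case: ifP => // _; rewrite eqxx.
- exact: bsupp_uniq.
rewrite /S rmorph_sum big_mkcond -sumrB; apply: (maxid_sum HO) => m _.
rewrite /= bcoef_wpart -surjective_pairing.
case: eqP => _; last by rewrite mul0r rmorph0 subrr; exact: maxid0.
rewrite rmorphM -mulrBr; apply: (maxidM HO); first by case: HO => -[].
rewrite !exprnP !exprz_exp -expfzDr //.
exact: (maxid_expz_sub HO).
Qed.

End Residue.

(* The valuation is monomial at [x, y]: up to units it only sees the weight [(p, q)],
   and [(xi, eta)] is the residual point on the torus. *)
Lemma place_weight : exists (p q : int) (t : K) (xi eta : C),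
  [/\ 0 < p \/ 0 < q, ~ O t, xi != 0 /\ eta != 0,
      forall m, vunit O ((x ^+ m.1 * y ^+ m.2) / t ^ (wt p q m)) &
      forall f d, wle p q d f ->
        maxid O (ev j x y f / t ^ d - j (beval (wpart p q d f) xi eta))].
Proof.
have [e1 [e2 [n1 [n2 [E Uu Ot]]]]] := primitive_tie.
have [l l0 Ml] := residue_exists E Uu Ot.
set t := x ^ (- n2) * y ^ n1 in Ot *.
have t0 : t != 0 by rewrite mulf_neq0 ?expfz_neq0.
have OM a b : O a -> O b -> O (a * b) by case: HO => -[_ _ OM] _; apply: OM.
exists (- e2), e1, t, (l ^ n1), (l ^ n2); split=> //.
(* Were [p] and [q] both nonpositive, [x] and [y] would be units times nonpositive powers of [t],
   hence in [O]. *)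
- apply: contrapT => /not_orP [/negP p0 /negP q0]; apply: Oxy.
  have H m : wt (- e2) e1 m <= 0 -> O (x ^+ m.1 * y ^+ m.2).
    rewrite (monomial_split _ E) -/t => le; apply: OM.
      by case: (vunitXz HO (wt n1 n2 m) Uu).
    move: le; rewrite le_eqVlt => /orP[/eqP ->|lt]; first by rewrite expr0z.
    exact/(maxid_sub HO)/neg_power_maxid.
  split; [have := H (1, 0)%N|have := H (0, 1)%N];
    rewrite /= expr0 expr1 ?mulr1 ?mul1r; apply; rewrite /wt /=; lia.
- by split; exact: expfz_neq0.
- move=> m; rewrite (monomial_split _ E) -/t mulfK ?expfz_neq0 //.
  exact: (vunitXz HO _ Uu).
- by move=> f d; exact: residue_wpart.
Qed.

End Place.

(** * Near irreducibility *)

Section NearlyIrreducible.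
Variable C : numClosedFieldType.
Implicit Types (f g h k : {poly {poly C}}) (m : nat * nat).

Definition meets_axes f :=
  (exists a, bcoef f a 0 != 0) /\ (exists b, bcoef f 0 b != 0).

(** A monomial on an axis only arises as a product of monomials on the same axis. *)
Lemma meets_axes_factor g k : meets_axes (g * k) -> meets_axes g.
Proof.
move=> [[a Ha] [b Hb]]; split; apply: contrapT => H.
  case/eqP: Ha; rewrite bcoefM big1 // => i _; rewrite big_ord1.
  have -> : bcoef g i (@ord0 0) = 0; last by rewrite mul0r.
  by apply/eqP; apply: contrapT => /negP ?; apply: H; exists i.
case/eqP: Hb; rewrite bcoefM big_ord1 big1 // => i _.
have -> : bcoef g (@ord0 0) i = 0; last by rewrite mul0r.
by apply/eqP; apply: contrapT => /negP ?; apply: H; exists i.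
Qed.

Section Point.
Variables (K : fieldType) (j : {rmorphism C -> K}) (x y : K).
Hypothesis xyC : ~ ((exists c, x = j c) /\ (exists c, y = j c)).

(** If one coordinate vanished, the other would be a root of the restriction of [g] to an axis,
    which is a nonzero polynomial over [C]; both coordinates would be constants. *)
Lemma generic_point_neq0 g : meets_axes g -> ev j x y g = 0 -> x != 0 /\ y != 0.
Proof.
have C0 : exists c, 0 = j c by exists 0; rewrite rmorph0.
move=> [[a Ha] [b Hb]] E; split; apply/eqP=> e; rewrite e in E; apply: xyC; rewrite e.
  split=> //; apply: (@algebraic_in_closed _ _ _ g`_0).
    by apply: contraNneq Hb => z; rewrite /bcoef z coef0.
  by move: E; rewrite /ev horner_coef0 coef_map.
split=> //; apply: (@algebraic_in_closed _ _ _ (map_poly (coefp 0) g)).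
  by apply: contraNneq Ha => z; rewrite /bcoef -/(coefp 0 _) -coef_map z coef0.
rewrite -[RHS]E /ev -map_poly_comp; congr _.[_]; apply: eq_map_poly => P /=.
by rewrite /horner_eval horner_coef0 coef_map.
Qed.

Lemma ev_valring (O : K -> Prop) f : valring j O -> O x -> O y -> O (ev j x y f).
Proof.
move=> [[Oj OD OM] _] Ox Oy; rewrite ev_bsupp.
have OX a n : O a -> O (a ^+ n).
  by move=> Oa; elim: n => [|n IH]; rewrite ?expr0 ?exprS; [rewrite -(rmorph1 j)|exact: OM].
apply: (big_ind O) => [|//|m _]; first by rewrite -(rmorph0 j).
by apply: (OM) => //; apply: (OM); exact: OX.
Qed.

(** A nonconstant ratio would be missed by some valuation ring [O]. Both kinds of [O] are excluded:
    those containing [x] and [y], and those at infinity. *)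
Lemma monomial_ratio_const g h u v m : g != 0 -> meets_axes g -> meets_axes h ->
  u * g + v * h = 1 -> ev j x y g = 0 ->
  (forall p q : int, 0 < p \/ 0 < q ->
    ~ exists xi eta : C, [/\ xi != 0, eta != 0,
        beval (initial_form g p%:~R q%:~R) xi eta = 0 &
        beval (initial_form h p%:~R q%:~R) xi eta = 0]) ->
  m \in bsupp h \/ m = (0, 0)%N ->
  exists c, x ^+ m.1 * y ^+ m.2 / ev j x y h = j c.
Proof.
move=> g0 ag ah uv gxy nondeg mh.
have [x0 y0] := generic_point_neq0 ag gxy.
have vh : ev j x y v * ev j x y h = 1.
  by rewrite -evM -(ev1 j x y) -uv evD !evM gxy mulr0 add0r.
have h0 : ev j x y h != 0 by apply: contra_eq_neq vh => ->; rewrite mulr0 eq_sym oner_neq0.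
apply: contrapT => nc.
have [|O HO OT] := @valring_avoiding C K j (x ^+ m.1 * y ^+ m.2 / ev j x y h).
  by move=> c Ec; apply: nc; exists c.
have [[Oj OD OM] _] := HO.
have Oxy : ~ (O x /\ O y).
  (* Here [1 / h(x, y) = v(x, y)] is a polynomial in elements of [O]. *)
  move=> [Ox Oy]; apply: OT; rewrite -[_^-1]mul1r -vh mulfK //.
  apply: (OM); last exact: ev_valring.
  have := ev_valring ('X^(m.1) * ('X^(m.2))%:P) HO Ox Oy.
  by rewrite evM /ev map_polyXn map_polyC hornerXn hornerC /=
    map_polyXn /horner_eval hornerXn.
have [p [q [t [xi [eta [pq Ot [xi0 eta0] mono res]]]]]] :=
  place_weight x0 y0 HO Oxy g0 gxy.
have t0 : t != 0 by apply/eqP=> e; apply: Ot; rewrite e -(rmorph0 j).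
have hn0 : h != 0.
  by case: ah => -[a Ha] _; apply: contraNneq Ha => ->; rewrite /bcoef !coef0.
have [d tg] := wtop_exists p q g0; have [e th] := wtop_exists p q hn0.
have := res _ _ tg.1; rewrite gxy mul0r sub0r => /(maxidN HO).
rewrite opprK => /(maxid_closed HO) zg.
apply: (nondeg p q pq); exists xi, eta; split=> //.
  by rewrite (initial_form_wpart tg).
rewrite (initial_form_wpart th); apply/eqP; apply: contrapT => /negP zh.
(* The residue of this quotient is the value of the top part of [h] at [(xi, eta)], nonzero by [zh];
   so the quotient is a unit. *)
have [r0 Or] : ev j x y h / t ^ e != 0 /\ O (ev j x y h / t ^ e)^-1.
  apply: (nmaxid_unit (O := O)) => Mr.
  have /maxid_closed : maxid O (j (beval (wpart p q e h) xi eta)).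
    have -> : j (beval (wpart p q e h) xi eta) = ev j x y h / t ^ e -
      (ev j x y h / t ^ e - j (beval (wpart p q e h) xi eta)) by rewrite opprB addrC subrK.
    by apply: (maxidD HO) => //; apply: (maxidN HO); apply: res th.1.
  by move=> /(_ HO) z; rewrite z eqxx in zh.
have le : wt p q m <= e.
  (* For the monomial 1, the bound [0 <= e] comes from a monomial of [h] on the axis whose weight
     coordinate is positive. *)
  case: mh => [/th.1 //|->]; rewrite /wt /= !mulr0 addr0.
  case: ah => -[a Ha] [b Hb]; case: pq => pq.
    have := th.1 (a, 0%N); rewrite mem_bsupp => /(_ Ha).
    by apply: le_trans; rewrite /wt /= mulr0 addr0 mulr_ge0 // ltW.
  have := th.1 (0%N, b); rewrite mem_bsupp => /(_ Hb).
  by apply: le_trans; rewrite /wt /= mulr0 add0r mulr_ge0 // ltW.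
apply: OT.
have -> : x ^+ m.1 * y ^+ m.2 / ev j x y h =
  (x ^+ m.1 * y ^+ m.2) / t ^ (wt p q m) *
  ((ev j x y h / t ^ e)^-1 * t ^ (wt p q m - e)).
  rewrite expfzDr // -invr_expz; field.
  by rewrite h0 !expfz_neq0.
apply: (OM); first by case: (mono m).
apply: OM => //; move: le; rewrite -subr_le0 le_eqVlt => /orP[/eqP ->|lt].
  by rewrite expr0z -(rmorph1 j).
exact/(maxid_sub HO)/(neg_power_maxid HO).
Qed.

(** From two constant monomials with independent exponents, eliminating [y] or [x] leaves a
    nontrivial algebraic equation over [C] for the other coordinate; both would be constants. *)
Lemma bsupp_collinear h : x != 0 -> y != 0 ->
  (forall m, m \in bsupp h -> exists c, x ^+ m.1 * y ^+ m.2 = j c) ->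
  forall m n, m \in bsupp h -> n \in bsupp h -> (m.1 * n.2 = n.1 * m.2)%N.
Proof.
move=> x0 y0 cst m n /cst [c Ec] /cst [d Ed].
apply/eqP; apply: contrapT => /negP ne; apply: xyC.
have jc0 : j c != 0 by rewrite -Ec mulf_neq0 ?expf_neq0.
have jd0 : j d != 0 by rewrite -Ed mulf_neq0 ?expf_neq0.
have alg z a b al be : a != b -> al != 0 -> j al * z ^+ a = j be * z ^+ b ->
    exists c, z = j c.
  move=> ab al0 Eq; apply: (@algebraic_in_closed _ _ _ (al *: 'X^a - be *: 'X^b)).
    apply: contraNneq al0 => /(congr1 (fun P : {poly C} => P`_a)).
    by rewrite coefB !coefZ !coefXn eqxx (negPf ab) mulr1 mulr0 subr0 coef0 => ->.
  by rewrite rmorphB /= !map_polyZ !map_polyXn hornerD hornerN !hornerZ !hornerXn Eq subrr.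
split.
  apply: (@alg x _ _ (d ^+ m.2) (c ^+ n.2) ne).
    by rewrite expf_neq0 // -(fmorph_eq0 j).
  rewrite !rmorphXn -Ec -Ed /= !exprMn -!exprM [(n.2 * m.2)%N]mulnC.
  by ring.
apply: (@alg y (m.2 * n.1)%N (m.1 * n.2)%N (d ^+ m.1) (c ^+ n.1)).
- by rewrite mulnC eq_sym.
- by rewrite expf_neq0 // -(fmorph_eq0 j).
rewrite !rmorphXn -Ec -Ed /= !exprMn -!exprM [(n.1 * m.1)%N]mulnC [(n.2 * m.1)%N]mulnC.
by ring.
Qed.

End Point.

Lemma initial_form_flat h (p q : int) : h != 0 ->
  (forall m, m \in bsupp h -> wt p q m = 0) -> initial_form h p%:~R q%:~R = h.
Proof.
move=> h0 H; have E : wpart p q 0 h = h.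
  apply: bpolyP => a b; rewrite bcoef_wpart; case: eqP => // ne.
  apply/esym/eqP; apply: contrapT => /negP nz; apply: ne; apply: H.
  by rewrite mem_bsupp.
rewrite (@initial_form_wpart _ _ _ 0) //; split; last by rewrite E.
by move=> m /H ->.
Qed.

End NearlyIrreducible.

Theorem theorem1p2 (C : numClosedFieldType) (f : {poly {poly C}}) :
  quasi_convenient f ->
  nondegenerate_at_infinity f ->
  (forall p q : C, p \is Num.real -> q \is Num.real ->
     (p != 0 \/ q != 0) -> p * q <= 0 ->
     ~ (exists x y : C, x != 0 /\ y != 0 /\
          beval (initial_form f p q) x y = 0 /\
          beval (initial_form f (- p) (- q)) x y = 0)) ->
  nearly_irreducible f.
Proof.
move=> [posf axf] [_ nondeg] cond2; split=> // g h posg posh [k Eg] [l Eh].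
apply: contrapT => nz.
have pos_neq0 (F : {poly {poly C}}) : pos_deg F -> F != 0.
  by move=> [a [b [_ nzF]]]; apply: contraNneq nzF => ->; rewrite /bcoef !coef0.
have f0 := pos_neq0 _ posf; have g0 := pos_neq0 _ posg; have h0 := pos_neq0 _ posh.
have [u [v uv]] := nullstellensatz2 g0 h0 nz.
have [w Ef] : exists w, f = g * (h * w).
  (* From [f = g k = h l] follows [k = (u g + v h) k = h (u l + v k)]. *)
  exists (u * l + v * k); rewrite {1}Eg; congr (_ * _).
  by rewrite -[k in LHS]mul1r -uv mulrDl mulrAC -mulrA -[k * g]mulrC -Eg Eh; ring.
have w0 : w != 0 by apply: contraNneq f0 => e; rewrite Ef e !mulr0.
have ag : meets_axes g by apply: (@meets_axes_factor _ _ k); rewrite -Eg.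
have ah : meets_axes h by apply: (@meets_axes_factor _ _ l); rewrite -Eh.
have [K [j [x [y [gxy xyC]]]]] := generic_point posg.
have [x0 y0] := generic_point_neq0 xyC ag gxy.
have cst m : m \in bsupp h \/ m = (0, 0)%N ->
    exists c, x ^+ m.1 * y ^+ m.2 / ev j x y h = j c.
  apply: (monomial_ratio_const xyC g0 ag ah uv gxy) => p q pq [xi [eta [xi0 eta0 zg zh]]].
  (* A common torus zero of the initial forms of [g] and [h] is a zero of their product together
     with its partial derivatives, hence a singular zero of the initial form of [f]. *)
  apply: (nondeg p%:~R q%:~R); rewrite ?realz ?ltr0z //.
  exists xi, eta; rewrite Ef !initial_formM ?mulf_neq0 //.
  do 2!split=> //; split; first by rewrite bevalM zg mul0r.
  by rewrite /dX derivM dYM !bevalD !bevalM zg zh !mul0r !mulr0 !addr0.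
(* The monomial 1 shows that [1 / h(x, y)] is a constant [c0]; dividing by it makes the monomials of
   [h] constant. *)
have [c0 E0] := cst _ (or_intror erefl).
have col := bsupp_collinear xyC x0 y0 (h := h) _.
have {}col m n : m \in bsupp h -> n \in bsupp h -> (m.1 * n.2 = n.1 * m.2)%N.
  apply: col => m' m'h; have [c Ec] := cst _ (or_introl m'h).
  have H0 : j c0 != 0.
    rewrite -E0 /= !expr0 !mul1r invr_eq0; apply: contraTneq (oner_neq0 K) => z.
    by rewrite negbK -(ev1 j x y) -uv evD !evM gxy z !mulr0 addr0.
  exists (c / c0); rewrite fmorph_div -Ec -E0 /= !expr0 mul1r mul1r invrK.
  rewrite -E0 /= !expr0 !mul1r invr_eq0 in H0; by rewrite divfK.
have [a [b [ab hab]]] := posh.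
(* This weight is orthogonal to [(a, b)], hence to the whole support of [h], and [p q = - a b] is
   not positive. *)
pose p : int := - b%:Z; pose q : int := a%:Z.
have flat m : m \in bsupp h -> wt p q m = 0.
  move=> mh; have : (a, b) \in bsupp h by rewrite mem_bsupp.
  by move/col => /(_ _ mh) /= E; rewrite /wt /p /q; lia.
have flatN m : m \in bsupp h -> wt (- p) (- q) m = 0.
  by move/flat; rewrite /wt !mulNr -opprD => ->; rewrite oppr0.
(* The support of [h] meets both axes and [(a, b)] is not the origin, so it cannot be the only
   exponent. *)
have [n nh nab] : exists2 n, n \in bsupp h & n != (a, b).
  case: ah => -[a' Ha] [b' Hb]; have [e1|ne] := eqVneq (a', 0%N) (a, b); last first.
    by exists (a', 0%N); rewrite ?mem_bsupp.
  have [e2|ne] := eqVneq (0%N, b') (a, b); last by exists (0%N, b'); rewrite ?mem_bsupp.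
  by move: ab; case: e1 => _ <-; case: e2 => <-.
have habh : (a, b) \in bsupp h by rewrite mem_bsupp.
have [xi [eta [xi0 eta0 zh]]] := torus_zero nab nh habh.
apply: (cond2 p%:~R q%:~R); rewrite ?realz //.
- rewrite !intr_eq0 /p /q oppr_eq0.
  case: a ab {habh hab nab p q flat flatN} => [|a] ab; last by right.
  by left; case: b ab.
- by rewrite -intrM -[0](@mulr0z C 1) ler_int /p /q; nia.
exists xi, eta; do 2!split=> //.
(* For both opposite weights the initial form of [h] is [h] itself, so its zero is common to both
   initial forms of [f]. *)
rewrite -!rmorphN Ef !initial_formM ?mulf_neq0 //.
by rewrite !(initial_form_flat h0) // !bevalM zh !(mul0r, mulr0).
Qed.
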